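(* Let $\pi_1,\pi_2$ range over pairs of projections of $\mathbb P^n$ with distinct centers, given by projection matrices $(\mathbf M_1,\mathbf M_2)$. For any $2\le k\le n-1$, the fundamental matrix of order $k$, $\mathbf F_k$, is invariant on each orbit of the action $\varrho$ of the projective group $\mathbb PGL_{n+1}(\mathbb C)$ on pairs of projection matrices. Moreover each pair of projection matrices $(\mathbf M_1,\mathbf M_2)$ is equivalent (under $\varrho$) to a pair of the form $([\mathbf I,\mathbf 0],[\mathbf H,\mathbf e_2])$, where $\mathbf e_2$ is the second epipole and the matrix $\mathbf H$ depends on $\mathbf F_{n-1}$ (is a function of $\mathbf F_{n-1}$).
   Context: Everything is over $\mathbb C$. A projection $\pi_j:\mathbb P^n\setminus\{\mathbf O_j\}\to i_j(\mathbb P^{n-1})$ from a point $\mathbf O_j$ (the center) onto an embedded hyperplane is presented, once bases are fixed, by a full-rank $n\times(n+1)$ matrix $\mathbf M_j$, defined up to non-zero scalar, with kernel $\mathbf O_j$. The action $\varrho$ of $\mathbf A\in\mathbb PGL_{n+1}(\mathbb C)$ on pairs of projection matrices (up to scalars) is $(\mathbf M_1,\mathbf M_2)\mapsto(\mathbf M_1\mathbf A^{-1},\mathbf M_2\mathbf A^{-1})$. The centers $\mathbf O_1\ne\mathbf O_2$ are distinct. The first and second epipoles are $\mathbf e_1=\pi_1(\mathbf O_2)$ and $\mathbf e_2=\pi_2(\mathbf O_1)$. For $2\le k\le n-1$ the fundamental matrix of order $k$, $\mathbf F_k$, of $(\pi_1,\pi_2)$ is the matrix, defined up to non-zero scalar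 and of size $\binom{n}{n-k+1}\times\binom{n}{n-k}$, of the linear map $\wedge^{n-k}\mathbb C^n\to\wedge^{n-k+1}\mathbb C^n$ that sends an extensor (decomposable element) representing an $(n-1-k)$-plane $W\subset i_1(\mathbb P^{n-1})$ not containing $\mathbf e_1$ to an extensor representing the $(n-k)$-plane $\pi_2(\pi_1^{-1}(W))$ of $i_2(\mathbb P^{n-1})$ (which contains $\mathbf e_2$). Explicitly, $\mathbf F_k=\widetilde{\mathbf M}_{2,k}\widehat{\mathbf M}_{1,k}$ where $\widehat{\mathbf M}_{1,k}$ sends an extensor of $W$ to an extensor of the $(n-k)$-plane of $\mathbb P^n$ generated by $\mathbf O_1$ and $W$ (the closure of $\pi_1^{-1}(W)$), and $\widetilde{\mathbf M}_{2,k}(\mathbf w_1\wedge\cdots\wedge\mathbf w_{n-k+1})=\mathbf M_2\mathbf w_1\wedge\cdots\wedge\mathbf M_2\mathbf w_{n-k+1}$. $\mathbf F_{n-1}$ is called the reduced fundamental matrix; it sends points of $i_1(\mathbb P^{n-1})$ to lines of $i_2(\mathbb P^{n-1})$ through $\mathbf e_2$. *)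

(* Defs.v *)
From mathcomp Require Import all_boot all_order all_algebra.

Set Implicit Arguments.
Unset Strict Implicit.
Unset Printing Implicit Defensive.

Import GRing.Theory.
Local Open Scope ring_scope.

(* The standard basis of the r-th exterior power of F^m is indexed by the
   strictly increasing r-tuples in 'I_m, numbered by 'I_('C(m, r)). *)
Definition ext_idx (m r : nat) (i : 'I_('C(m, r))) : r.-tuple 'I_m :=
  enum_val (cast_ord (esym (card_ltn_sorted_tuples r m)) i).

Section Projections.
Variable F : fieldType.

(* Equality of matrices (or vectors) defined up to a nonzero scalar. *)
Definition projeq (m n : nat) (A B : 'M[F]_(m, n)) : Prop :=
  exists2 c : F, c != 0 & B = c *: A.

(* Coordinates of v_1 /\ ... /\ v_r, for v_1, ..., v_r the columns of V: these
   are the maximal minors of V. *)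
Definition wedge (m r : nat) (V : 'M[F]_(m, r)) : 'cV[F]_('C(m, r)) :=
  \col_i \det (rowsub (tnth (ext_idx i)) V).

(* The matrix of the r-th exterior power of A, sending w_1 /\ ... /\ w_r to
   A w_1 /\ ... /\ A w_r. Its columns are the images of the basis extensors,
   A e_(j_1) /\ ... /\ A e_(j_r), and A e_j is the column j of A. *)
Definition ext_mx (r p m : nat) (A : 'M[F]_(p, m)) :
    'M[F]_('C(p, r), 'C(m, r)) :=
  \matrix_(i, j) wedge (colsub (tnth (ext_idx j)) A) i 0.

(* P^n has homogeneous coordinates in F^(n + 1); we write n + 1, not n.+1, so
   that block matrices [H, e] typecheck. *)
Definition proj_mx (n : nat) (M : 'M[F]_(n, n + 1)) : bool := \rank M == n.

(* A vector representing the center: when M has rank n, it is nonzero and spans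
   the line of all v with M *m v = 0. (kermx computes left kernels, hence the
   transpositions.) *)
Definition center (n : nat) (M : 'M[F]_(n, n + 1)) : 'cV[F]_(n + 1) :=
  (nz_row (kermx M^T))^T.

Definition proj_pair (n : nat) (M1 M2 : 'M[F]_(n, n + 1)) : Prop :=
  [/\ proj_mx M1, proj_mx M2 & ~ projeq (center M1) (center M2)].

Definition epipole2 (n : nat) (M1 M2 : 'M[F]_(n, n + 1)) : 'cV[F]_n :=
  M2 *m center M1.

(* The matrix sending an extensor w_1 /\ ... /\ w_r of W to the extensor
   O /\ v_1 /\ ... /\ v_r of the span of the center O and W, where M v_i = w_i.
   When M has rank n, pinvmx M is a right inverse of M, i.e., an embedding of
   the target hyperplane as a complement of O; another choice of the lifts v_i
   changes them by multiples of O, and so does not change the extensor. *)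
Definition join_mx (r n : nat) (M : 'M[F]_(n, n + 1)) :
    'M[F]_('C(n + 1, 1 + r), 'C(n, r)) :=
  \matrix_(i, j)
    wedge (row_mx (center M) (colsub (tnth (ext_idx j)) (pinvmx M))) i 0.

(* A representative of the fundamental matrix of order k, which is itself
   defined only up to a nonzero scalar. *)
Definition fundamental_mx (n k : nat) (M1 M2 : 'M[F]_(n, n + 1)) :
    'M[F]_('C(n, 1 + (n - k)), 'C(n, n - k)) :=
  ext_mx (1 + (n - k)) M2 *m join_mx (n - k) M1.

(* The pairs (M1, M2) and (N1, N2), with entries up to nonzero scalars, are in
   the same orbit of PGL_(n+1)(F). *)
Definition rho_equiv (n : nat) (M1 M2 N1 N2 : 'M[F]_(n, n + 1)) : Prop :=
  exists A : 'M[F]_(n + 1),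
    [/\ A \in unitmx, projeq (M1 *m invmx A) N1 & projeq (M2 *m invmx A) N2].

End Projections.

(* Main.v *)
Require Import Defs.
From mathcomp Require Import all_boot all_order all_fingroup all_algebra.
From mathcomp Require Import boolp reals complex.
From mathcomp Require classical_sets.
From mathcomp Require Import zify ring.

(** Write [c] for the center of [M1], [P] for [pinvmx M1], a right inverse of
    [M1], and [e = M2 c]. By the Cauchy-Binet formula the column of [F_k] of
    index [J] is the extensor [e /\ (columns J of M2 P)]. Moving [(M1, M2)] in
    its orbit rescales [e] and replaces [M2 P] by [s M2 P + e v], so [F_k] is
    only rescaled.
    Conversely, [F_(n-1)] records the bivectors [e /\ h_j], where the [h_j] are
    the columns of [M2 P]. Since [n > 2] and the [h_j] together with [e] span
    the whole space, these bivectors up to a common scalar determine [e] up to a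
    scalar, and [M2 P] up to [M2 P |-> s M2 P + e v]. These are precisely the
    changes of the second matrix [[M2 P, e]] allowed by the elements of PGL that
    preserve [[I, 0]], so any choice of [H] realizing [F_(n-1)] will do. *)

Set Implicit Arguments.
Unset Strict Implicit.
Unset Printing Implicit Defensive.

Import GRing.Theory.
Local Open Scope ring_scope.

Lemma ext_idx_sorted (m r : nat) (i : 'I_('C(m, r))) :
  sorted ltn (map val (ext_idx i)).
Proof.
rewrite /ext_idx; set k := cast_ord _ _.
by have := enum_valP k; rewrite inE.
Qed.

Lemma ext_idx_inj (m r : nat) : injective (@ext_idx m r).
Proof. by move=> i j /enum_val_inj /cast_ord_inj. Qed.

Lemma ext_idx_surj (m r : nat) (t : r.-tuple 'I_m) :
  sorted ltn (map val t) -> exists i, ext_idx i = t.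
Proof.
move=> st.
have tin : t \in [set t : r.-tuple 'I_m | sorted ltn (map val t)].
  by rewrite inE.
exists (cast_ord (card_ltn_sorted_tuples r m) (enum_rank_in tin t)).
by rewrite /ext_idx cast_ordK enum_rankK_in.
Qed.

Lemma ext_idx_uniq (m r : nat) (i : 'I_('C(m, r))) : uniq (ext_idx i).
Proof.
rewrite -(map_inj_uniq val_inj); apply: (sorted_uniq ltn_trans ltnn).
exact: ext_idx_sorted.
Qed.

Lemma tnth_ext_idx_inj (m r : nat) (i : 'I_('C(m, r))) :
  injective (tnth (ext_idx i)).
Proof. by apply/tuple_uniqP; apply: ext_idx_uniq. Qed.

Definition perm_ext_idx (m r : nat) (p : 'I_('C(m, r)) * 'S_r) :
    {ffun 'I_r -> 'I_m} :=
  [ffun a => tnth (ext_idx p.1) (p.2 a)].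

Lemma perm_ext_idx_inj (m r : nat) : injective (@perm_ext_idx m r).
Proof.
move=> [i s] [j t] /ffunP eq_ij.
have sub (i' j' : 'I_('C(m, r))) (s' t' : 'S_r) :
    (forall a, perm_ext_idx (i', s') a = perm_ext_idx (j', t') a) ->
    {subset ext_idx i' <= ext_idx j'}.
  move=> eq' x /tnthP[a ->].
  have := eq' ((s'^-1)%g a); rewrite !ffunE /= permKV => ->; exact: mem_tnth.
have ij : i = j.
  apply: ext_idx_inj; apply: val_inj; apply: (inj_map val_inj).
  apply: (irr_sorted_eq ltn_trans ltnn); try exact: ext_idx_sorted.
  apply: eq_mem_map => x.
  by apply/idP/idP; [apply: (sub i j s t)|apply: (sub j i t s)].
rewrite ij in eq_ij *; congr (_, _); apply/permP => a.
by have := eq_ij a; rewrite !ffunE /= => /tnth_ext_idx_inj.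
Qed.

(* Inclusion plus a count: both sides have 'C(m, r) * r`! elements. *)
Lemma perm_ext_idx_image (m r : nat) :
  [set perm_ext_idx p | p in [set: 'I_('C(m, r)) * 'S_r]] =
  [set f : {ffun 'I_r -> 'I_m} | injectiveb f].
Proof.
apply/eqP; rewrite eqEcard; apply/andP; split.
  apply/subsetP => _ /imsetP[[i s] _ ->]; rewrite inE; apply/injectiveP => a b.
  by rewrite !ffunE => /tnth_ext_idx_inj /perm_inj.
rewrite card_inj_ffuns !card_ord card_imset; last exact: perm_ext_idx_inj.
by rewrite cardsT card_prod card_ord card_Sn bin_ffact.
Qed.

Lemma det_mulmx_sum_ffun (R : comNzRingType) (m r : nat) (B : 'M[R]_(r, m))
    (V : 'M[R]_(m, r)) :
  \det (B *m V) =
  \sum_(f : {ffun 'I_r -> 'I_m}) (\prod_i B i (f i)) * \det (rowsub f V).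
Proof.
under eq_bigr => f _ do rewrite big_distrr /=.
rewrite exchange_big /=; apply: eq_bigr => s _.
under eq_bigr => i _ do rewrite mxE.
rewrite bigA_distr_bigA big_distrr /=; apply: eq_bigr => f _.
rewrite big_split /= mulrCA; congr (_ * (_ * _)).
by apply: eq_bigr => i _; rewrite mxE.
Qed.

Lemma Cauchy_Binet (R : comNzRingType) (m r : nat) (B : 'M[R]_(r, m))
    (V : 'M[R]_(m, r)) :
  \det (B *m V) = \sum_(i < 'C(m, r))
    \det (colsub (tnth (ext_idx i)) B) * \det (rowsub (tnth (ext_idx i)) V).
Proof.
rewrite det_mulmx_sum_ffun.
rewrite (bigID (fun f : {ffun 'I_r -> 'I_m} => injectiveb f)) /=.
rewrite [X in _ + X]big1 ?addr0; last first.
  move=> f /injectivePn[a [b ab fab]].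
  by rewrite (determinant_alternate ab) ?mulr0// => j; rewrite !mxE fab.
rewrite (eq_bigl (mem [set f : {ffun 'I_r -> 'I_m} | injectiveb f])); last first.
  by move=> f; rewrite [RHS]inE.
rewrite -perm_ext_idx_image big_imset /=; last first.
  by move=> p q _ _; apply: perm_ext_idx_inj.
rewrite (eq_bigl xpredT) => [|p]; last by rewrite inE.
rewrite -(pair_bigA _ (fun i s => (\prod_a B a (perm_ext_idx (i, s) a)) *
   \det (rowsub (perm_ext_idx (i, s)) V))) /=.
apply: eq_bigr => i _; rewrite [X in X * _]/determinant big_distrl /=.
apply: eq_bigr => s _.
have -> : rowsub (perm_ext_idx (i, s)) V =
    row_perm s (rowsub (tnth (ext_idx i)) V).
  by apply/matrixP => a b; rewrite !mxE ffunE.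
rewrite row_permE det_mulmx det_perm mulrCA mulrA; congr (_ * _ * _).
by apply: eq_bigr => a _; rewrite ffunE mxE.
Qed.

Lemma mul_ext_mx_wedge (F : fieldType) (p m r : nat) (A : 'M[F]_(p, m))
    (V : 'M[F]_(m, r)) :
  ext_mx r A *m wedge V = wedge (A *m V).
Proof.
apply/colP => i; rewrite !mxE -mul_rowsub_mx Cauchy_Binet.
apply: eq_bigr => j _; rewrite !mxE; congr (\det _ * _).
by apply/matrixP => a b; rewrite !mxE.
Qed.

(* [proj_mx M] of Defs.v unfolds to [row_free M]; the short name [proj_mx] is
   shadowed by the projector of mxalgebra. *)
Section CenterTheory.
Variables (F : fieldType) (n : nat).
Implicit Types M : 'M[F]_(n, n + 1).

Lemma mul_center M : M *m center M = 0.
Proof.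
apply: trmx_inj; rewrite trmx_mul trmxK trmx0.
by apply/sub_kermxP; apply: nz_row_sub.
Qed.

Lemma rank_kermx_row_free M : row_free M -> \rank (kermx M^T) = 1%N.
Proof. by move=> /eqP rM; rewrite mxrank_ker mxrank_tr rM addKn. Qed.

Lemma center_neq0 M : row_free M -> center M != 0.
Proof.
move=> pM; rewrite /center -trmx0 (inj_eq trmx_inj) nz_row_eq0 -mxrank_eq0.
by rewrite rank_kermx_row_free.
Qed.

Lemma mulmx_center_eq0 M p (V : 'M[F]_(n + 1, p)) :
  row_free M -> M *m V = 0 -> exists u, V = center M *m u.
Proof.
move=> fM MV.
have : (V^T <= nz_row (kermx M^T))%MS.
  have VK : (V^T <= kermx M^T)%MS.
    by apply/sub_kermxP; rewrite -trmx_mul MV trmx0.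
  have /eqmxP E : (nz_row (kermx M^T) == kermx M^T)%MS.
    rewrite -(geq_leqif (mxrank_leqif_eq (nz_row_sub _))).
    rewrite rank_kermx_row_free //.
    by rewrite lt0n mxrank_eq0 nz_row_eq0 -mxrank_eq0 rank_kermx_row_free.
  by rewrite E.
move=> /submxP[u /(congr1 trmx)]; rewrite trmxK trmx_mul => VE.
by exists u^T.
Qed.

Lemma mulmx_center_eq0_col M (v : 'cV[F]_(n + 1)) :
  row_free M -> M *m v = 0 -> exists c, v = c *: center M.
Proof.
move=> fM /(mulmx_center_eq0 fM)[u ->]; exists (u 0 0).
by rewrite [u]mx11_scalar mul_mx_scalar mxE eqxx.
Qed.

Lemma row_mx_pinv_center_inv M :
  row_free M ->
  exists w, col_mx M w *m row_mx (pinvmx M) (center M) = 1%:M.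
Proof.
move=> pM.
have [w0 w0c] : exists w0, w0 *m center M = 1%:M.
  move: (center M) (center_neq0 pM) => c /cV0Pn[i ci].
  exists ((c i 0)^-1 *: delta_mx 0 i).
  by apply/matrixP => a b; rewrite !ord1 -scalemxAl -rowE !mxE eqxx mulVf.
exists (w0 - w0 *m pinvmx M *m M).
rewrite mul_col_row mulmxVp // mul_center [RHS]scalar_mx_block.
congr block_mx.
  by rewrite mulmxBl -[_ *m M *m _]mulmxA mulmxVp // mulmx1 subrr.
by rewrite mulmxBl -!mulmxA mul_center !mulmx0 subr0.
Qed.

End CenterTheory.

Section Fundamental.
Variables (F : fieldType) (n : nat).
Implicit Types M N : 'M[F]_(n, n + 1).

Lemma col_mulmx m p q (A : 'M[F]_(m, p)) (B : 'M[F]_(p, q)) j :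
  col j (A *m B) = A *m col j B.
Proof. by rewrite !colE mulmxA. Qed.

Lemma wedge_mulmxr m r (V : 'M[F]_(m, r)) (C : 'M[F]_r) :
  wedge (V *m C) = \det C *: wedge V.
Proof.
by apply/colP => i; rewrite !mxE -mul_rowsub_mx det_mulmx mulrC.
Qed.

Lemma col_ext_mx_join r M1 M2 j :
  col j (ext_mx (1 + r) M2 *m join_mx r M1) =
  wedge (row_mx (M2 *m center M1)
                (colsub (tnth (ext_idx j)) (M2 *m pinvmx M1))).
Proof.
rewrite col_mulmx.
have -> : col j (join_mx r M1) =
    wedge (row_mx (center M1) (colsub (tnth (ext_idx j)) (pinvmx M1))).
  by apply/colP => i; rewrite !mxE.
by rewrite mul_ext_mx_wedge mul_mx_row mulmx_colsub.
Qed.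

Lemma ext_mx_join_rho_equiv r M1 M2 N1 N2 :
  row_free M1 -> rho_equiv M1 M2 N1 N2 ->
  projeq (ext_mx (1 + r) M2 *m join_mx r M1)
         (ext_mx (1 + r) N2 *m join_mx r N1).
Proof.
move=> fM1 [A [uA [a a0 N1E] [b b0 N2E]]].
have fN1 : row_free N1.
  rewrite /row_free N1E eqmx_scale // mxrankMfree //.
  by rewrite row_free_unit unitmx_inv.
have [c cE] : exists c, invmx A *m center N1 = c *: center M1.
  apply: mulmx_center_eq0_col => //; apply: (scalerI a0).
  by rewrite mulmxA scalemxAl -N1E mul_center scaler0.
have c0 : c != 0.
  apply: contraTneq (center_neq0 fN1) => c0; rewrite negbK.
  by rewrite -(mulKVmx uA (center N1)) cE c0 scale0r mulmx0.
have [u PE] : exists u, invmx A *m pinvmx N1 =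
    a^-1 *: pinvmx M1 + center M1 *m u.
  have [|u uE] := @mulmx_center_eq0 _ _ M1 _
      (invmx A *m pinvmx N1 - a^-1 *: pinvmx M1) fM1.
    apply: (scalerI a0); rewrite scaler0 mulmxBr scalerBr mulmxA scalemxAl -N1E.
    by rewrite -scalemxAr scalerA mulfV // scale1r !mulmxVp // subrr.
  by exists u; rewrite -uE addrC subrK.
have N2c : N2 *m center N1 = (b * c) *: (M2 *m center M1).
  by rewrite N2E -scalemxAl -mulmxA cE -scalemxAr scalerA.
have N2P : N2 *m pinvmx N1 =
    (b / a) *: (M2 *m pinvmx M1) + (M2 *m center M1) *m (b *: u).
  rewrite N2E -scalemxAl -mulmxA PE mulmxDr scalerDr -scalemxAr scalerA.
  by rewrite mulmxA -scalemxAr.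
exists (b * c * (b / a) ^+ r).
  by rewrite !mulf_neq0 ?expf_neq0 ?mulf_neq0 ?invr_neq0.
apply/matrixP => i j; move: i; apply: col_eq; rewrite linearZ /=.
rewrite !col_ext_mx_join N2c N2P.
set f := tnth _; set e := M2 *m center M1; set P := M2 *m pinvmx M1.
have -> : row_mx ((b * c) *: e)
    (colsub f ((b / a) *: P + e *m (b *: u))) =
  row_mx e (colsub f P) *m
    block_mx (b * c)%:M (b *: colsub f u) 0 (b / a)%:M.
  rewrite mul_row_block mulmx0 addr0 !mul_mx_scalar; congr row_mx.
  apply/matrixP => i k; rewrite !mxE addrC; congr (_ + _).
  by apply: eq_bigr => l _; rewrite !mxE.
by rewrite wedge_mulmxr det_ublock !det_scalar expr1.
Qed.

Lemma mulmx_row_pinv_center_free M1 M2 (w : 'rV[F]_n) :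
  row_free M1 -> row_free M2 ->
  w *m (M2 *m pinvmx M1) = 0 -> w *m (M2 *m center M1) = 0 -> w = 0.
Proof.
move=> fM1 fM2 wP wc; apply: (row_free_inj fM2); rewrite mul0mx.
have [v Q1] := row_mx_pinv_center_inv fM1.
by rewrite -(mulmx1 (w *m M2)) -(mulmx1C Q1) mulmxA mul_mx_row -!mulmxA wP wc
  row_mx0 mul0mx.
Qed.

End Fundamental.

Section SecondEpipole.
Variables (F : fieldType) (n : nat).
Implicit Types M N : 'M[F]_(n, n + 1).

Lemma projeq_sym m p (A B : 'M[F]_(m, p)) : projeq A B -> projeq B A.
Proof.
by case=> c c0 ->; exists c^-1; rewrite ?invr_neq0 // scalerA mulVf ?scale1r.
Qed.

Lemma projeq_trans m p (A B C : 'M[F]_(m, p)) :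
  projeq A B -> projeq B C -> projeq A C.
Proof.
move=> [c c0 ->] [d d0 ->]; exists (d * c); first exact: mulf_neq0.
by rewrite scalerA.
Qed.

Lemma epipole2_neq0 M1 M2 : proj_pair M1 M2 -> epipole2 M1 M2 != 0.
Proof.
move=> [fM1 fM2 cN]; apply/eqP => e0; apply: cN; apply: projeq_sym.
have [c cE] := mulmx_center_eq0_col fM2 e0; exists c => //.
by apply: contraTneq (center_neq0 fM1) => c0; rewrite cE c0 scale0r eqxx.
Qed.

Lemma det_mx2 (A : 'M[F]_(1 + 1)) : \det A = A 0 0 * A 1 1 - A 0 1 * A 1 0.
Proof.
rewrite (expand_det_row _ 0) big_ord_recl big_ord1 /cofactor !det_mx11 !mxE /=.
rewrite expr0 expr1 mulN1r mul1r mulrN.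
by congr (A _ _ * A _ _ - A _ _ * A _ _); apply: val_inj.
Qed.

Lemma wedge_row_mxP (e g e' g' : 'cV[F]_n) c :
  wedge (row_mx e' g') = c *: wedge (row_mx e g) ->
  forall i j, e' i 0 * g' j 0 - e' j 0 * g' i 0 =
              c * (e i 0 * g j 0 - e j 0 * g i 0).
Proof.
move=> wE.
have lt_case (i j : 'I_n) : (i < j)%N -> e' i 0 * g' j 0 - e' j 0 * g' i 0 =
              c * (e i 0 * g j 0 - e j 0 * g i 0).
  move=> ij; have [|k kE] := @ext_idx_surj n (1 + 1) [tuple i; j].
    by rewrite /= ij.
  have wkE (e1 g1 : 'cV[F]_n) :
      wedge (row_mx e1 g1) k 0 = e1 i 0 * g1 j 0 - e1 j 0 * g1 i 0.
    have rsE a b : rowsub (tnth (ext_idx k)) (row_mx e1 g1) a b =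
        row_mx e1 g1 (tnth [tuple i; j] a) b by rewrite mxE kE.
    have col0 x : row_mx e1 g1 x 0 = e1 x 0.
      by rewrite -(row_mxEl e1 g1); congr (row_mx _ _ _ _); apply: val_inj.
    have col1 x : row_mx e1 g1 x 1 = g1 x 0.
      by rewrite -(row_mxEr e1 g1); congr (row_mx _ _ _ _); apply: val_inj.
    by rewrite mxE det_mx2 !rsE !col0 !col1 [g1 i 0 * _]mulrC.
  by rewrite -!wkE wE mxE.
move=> i j; case: (ltngtP i j) => [/lt_case //|/lt_case ji|/val_inj ->].
  by rewrite -[LHS]opprB ji -mulrN opprB.
by rewrite !subrr mulr0.
Qed.

(* A covector [psi] killing both [e] and [e'] contracts [e /\ h_j] to a multiple
   of [e] and [e' /\ h'_j] to a multiple of [e']; hence [e] and [e'] are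
   proportional, as soon as [psi] does not kill some [h_j]. *)
Lemma wedge_pencil_eq (e e' : 'cV[F]_n) (h h' : 'M[F]_n) c :
  (2 < n)%N -> e != 0 -> c != 0 ->
  (forall w : 'rV_n, w *m h = 0 -> w *m e = 0 -> w = 0) ->
  (forall k i j, e' i 0 * h' j k - e' j 0 * h' i k =
                 c * (e i 0 * h j k - e j 0 * h i k)) ->
  exists s v, s != 0 /\ h' = s *: h + e *m v.
Proof.
move=> n_gt2 e0 c0 inj_he eqw.
have [psi psi0 [psi_e psi_e']] :
    exists2 psi : 'rV[F]_n, psi != 0 & psi *m e = 0 /\ psi *m e' = 0.
  exists (nz_row (kermx (row_mx e e'))).
    rewrite nz_row_eq0 -mxrank_eq0 mxrank_ker subn_eq0 -ltnNge.
    exact: leq_ltn_trans (rank_leq_col _) n_gt2.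
  have /sub_kermxP := nz_row_sub (kermx (row_mx e e')).
  by rewrite mul_mx_row -[0]row_mx0 => /eq_row_mx.
have [k psi_hk] : exists k, (psi *m h) 0 k != 0.
  by apply/rV0Pn; apply: contraNneq psi0 => psih; rewrite (inj_he psi).
have [t eE] : exists t, e = t *: e'.
  have ctr (x : 'cV[F]_n) (y : 'M[F]_n) j : psi *m x = 0 ->
      \sum_i psi 0 i * (x i 0 * y j k - x j 0 * y i k) =
      - ((psi *m y) 0 k * x j 0).
    move=> /matrixP/(_ 0 0); rewrite !mxE => psix.
    transitivity (\sum_i psi 0 i * x i 0 * y j k
                  - \sum_i psi 0 i * y i k * x j 0).
      by rewrite -sumrB; apply: eq_bigr => i _; ring.
    by rewrite -!mulr_suml psix mul0r sub0r.
  exists ((psi *m h') 0 k / (c * (psi *m h) 0 k)); apply/colP => j; rewrite mxE.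
  have : - ((psi *m h') 0 k * e' j 0) = c * - ((psi *m h) 0 k * e j 0).
    rewrite -!ctr // mulr_sumr; apply: eq_bigr => i _.
    by rewrite eqw mulrCA.
  move=> /eqP; rewrite mulrN eqr_opp => /eqP E.
  rewrite mulrAC E mulrA mulrAC mulfV ?mul1r // mulf_neq0 //.
have t0 : t != 0 by apply: contraNneq e0 => t0; rewrite eE t0 scale0r.
have [i0 e'i0] : exists i0, e' i0 0 != 0.
  by apply/cV0Pn; apply: contraNneq e0 => e'0; rewrite eE e'0 scaler0.
exists (c * t), (\row_k ((h' i0 k - c * t * h i0 k) / (t * e' i0 0))).
split; first exact: mulf_neq0.
apply/matrixP => i j; rewrite !mxE big_ord1 !mxE.
have := eqw j i0 i; rewrite eE !mxE => E.
have {}E : e' i0 0 * h' i j = e' i 0 * h' i0 j +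
   c * (t * e' i0 0 * h i j - t * e' i 0 * h i0 j).
  by rewrite -E addrC subrK.
apply: (mulfI e'i0); rewrite E; field; by rewrite t0 e'i0.
Qed.

Lemma ext_mx_join_projeq r M1 M2 N1 N2 :
  r = 1%N -> (2 < n)%N -> proj_pair M1 M2 ->
  projeq (ext_mx (1 + r) M2 *m join_mx r M1)
         (ext_mx (1 + r) N2 *m join_mx r N1) ->
  exists s v, s != 0 /\
    N2 *m pinvmx N1 = s *: (M2 *m pinvmx M1) + epipole2 M1 M2 *m v.
Proof.
move=> r1 n_gt2 pM [c c0 FE]; subst r; have [fM1 fM2 _] := pM.
apply: (@wedge_pencil_eq _ (epipole2 N1 N2) _ _ c) => //.
- exact: epipole2_neq0.
- by move=> w; apply: mulmx_row_pinv_center_free.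
move=> k i j; have [|l lE] := @ext_idx_surj n 1 [tuple k]; first by [].
have := congr1 (col l) FE; rewrite linearZ /= !col_ext_mx_join.
move=> /wedge_row_mxP/(_ i j); rewrite lE.
have tk (A : 'M[F]_n) a : colsub (tnth [tuple k]) A a 0 = A a k.
  by rewrite mxE.
by rewrite !tk.
Qed.

Lemma rho_equiv_normal_form M1 M2 s a (v : 'rV[F]_n) :
  row_free M1 -> s != 0 -> a != 0 ->
  rho_equiv M1 M2 (row_mx 1%:M 0)
    (row_mx (s *: (M2 *m pinvmx M1) + epipole2 M1 M2 *m v)
            (a *: epipole2 M1 M2)).
Proof.
move=> fM1 s0 a0.
have [w Q1] := row_mx_pinv_center_inv fM1.
pose B : 'M[F]_(n + 1) :=
  row_mx (pinvmx M1) (center M1) *m block_mx s%:M 0 v a%:M.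
have uB : B \in unitmx.
  rewrite unitmx_mul (mulmx1_unit Q1).2 unitmxE det_lblock !det_scalar.
  by rewrite unitfE mulf_neq0 ?expf_neq0.
exists (invmx B); split; first by rewrite unitmx_inv.
- exists s^-1; first by rewrite invr_neq0.
  rewrite invmxK /B mulmxA mul_mx_row mul_center mulmxVp // mul_row_block.
  by rewrite !mul0mx mulmx0 !addr0 mul1mx scale_row_mx scaler0
    scale_scalar_mx mulVf.
exists 1; first exact: oner_neq0.
rewrite invmxK scale1r /B mulmxA mul_mx_row mul_row_block.
by rewrite mulmx0 add0r !mul_mx_scalar.
Qed.

End SecondEpipole.

Theorem theorem2p1 (R : realType) (n : nat) :
  (forall k : nat, (2 <= k <= n - 1)%N ->
     forall M1 M2 N1 N2 : 'M[R[i]]_(n, n + 1),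
       proj_pair M1 M2 -> rho_equiv M1 M2 N1 N2 ->
       projeq (fundamental_mx k M1 M2) (fundamental_mx k N1 N2))
  /\
  ((2 <= n - 1)%N ->
   exists Hof : 'M[R[i]]_('C(n, 1 + (n - (n - 1))), 'C(n, n - (n - 1))) ->
                'M[R[i]]_n,
     (forall F F', projeq F F' -> Hof F = Hof F') /\
     (forall M1 M2 : 'M[R[i]]_(n, n + 1), proj_pair M1 M2 ->
      forall e2 : 'cV[R[i]]_n, projeq (epipole2 M1 M2) e2 ->
        rho_equiv M1 M2
          (row_mx 1%:M 0)
          (row_mx (Hof (fundamental_mx (n - 1) M1 M2)) e2))).
Proof.
split=> [k _ M1 M2 N1 N2 [fM1 _ _]|n_gt2]; first exact: ext_mx_join_rho_equiv.
(* [realizes F] depends only on the class of F up to scalars, and so does the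
   value chosen in it. *)
pose realizes F (H : 'M[R[i]]_n) := exists M1 M2,
  [/\ proj_pair M1 M2, projeq F (fundamental_mx (n - 1) M1 M2) &
      H = M2 *m pinvmx M1].
exists (fun F => classical_sets.xget 0 (realizes F)); split.
  move=> F F' FF'; congr (classical_sets.xget 0 _).
  apply/funext => H; apply/propext.
  split=> -[M1 [M2 [pM FM ->]]]; exists M1, M2; split=> //.
    exact: projeq_trans (projeq_sym FF') FM.
  exact: projeq_trans FF' FM.
move=> M1 M2 pM e2 [a a0 ->].
set F := fundamental_mx _ _ _.
have [|N1 [N2 [_ FN ->]]] := @classical_sets.xgetPex _ 0 (realizes F).
  exists (M2 *m pinvmx M1), M1, M2; split=> //.
  by exists 1; rewrite ?oner_neq0 ?scale1r.
have [||s [v [s0 ->]]] := ext_mx_join_projeq _ _ pM FN; [lia|lia|].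
by apply: rho_equiv_normal_form => //; case: pM.
Qed.
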